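(* (Delta method in large deviations.) Let $\mathcal X$ and $\mathcal Y$ be two metrizable linear topological spaces and let $d$ and $\rho$ be compatible metrics on $\mathcal X$ and $\mathcal Y$ respectively. Let $\mathcal D_\Phi$ and $\mathcal D_0$ be subsets of $\mathcal X$ and let $\Phi:\mathcal D_\Phi\to\mathcal Y$ be Hadamard differentiable at $\theta\in\mathcal D_\Phi$ tangentially to $\mathcal D_0$, with derivative $\Phi'_\theta$. Let $X_n:\Omega_n\to\mathcal D_\Phi$, $n\ge1$, be a sequence of maps defined on probability spaces $(\Omega_n,\mathcal F_n,P_n)$, and let $r_n$, $n\ge1$, be positive real numbers with $r_n\to+\infty$. If $\{r_n(X_n-\theta),n\ge1\}$ satisfies the large deviation principle with speed $\lambda(n)$ and rate function $I$, and $\{I<\infty\}\subset\mathcal D_0$, then $\{r_n(\Phi(X_n)-\Phi(\theta)),n\ge1\}$ satisfies the large deviation principle with speed $\lambda(n)$ and rate function $$I_{\Phi'_\theta}(y)=\inf\{I(x);\ \Phi'_\theta(x)=y\},\qquad y\in\mathcal Y.$$ Furthermore, if $\Phi'_\theta$ is defined and continuous on the whole space $\mathcal X$, then $\{r_n(\Phi(X_n)-\Phi(\theta))-\Phi'_\theta(r_n(X_n-\theta)),n\ge1\}$ satisfies the large deviation principle with speed $\lambda(n)$ and rate function $$I_{\Phi,\theta}(z)=\begin{cases}0,& z=0,\\ +\infty,&\text{otherwise.}\end{cases}$$ In particular, for any $\delta>0$, $$\limsup_{n\to\infty}\frac1{\lambda(n)}\log P_n^*\Bigl(\rho\bigl(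r_n(\Phi(X_n)-\Phi(\theta))-\Phi'_\theta(r_n(X_n-\theta)),0\bigr)\ge\delta\Bigr)=-\infty.$$
   Context: Hadamard differentiability. $\Phi:\mathcal D_\Phi\subset\mathcal X\to\mathcal Y$ is Hadamard differentiable at $\theta\in\mathcal D_\Phi$ tangentially to $\mathcal D_0\subset\mathcal X$ if there is a continuous mapping $\Phi'_\theta:\mathcal D_0\to\mathcal Y$ (linearity is not required) such that $\lim_{n\to\infty}\bigl(\Phi(\theta+t_nh_n)-\Phi(\theta)\bigr)/t_n=\Phi'_\theta(h)$ for all sequences $t_n\to0+$ and all $h_n\in\mathcal X$ converging to some $h\in\mathcal D_0$ with $\theta+t_nh_n\in\mathcal D_\Phi$ for every $n$. Large deviation principle (LDP). Let $(\mathcal X,d)$ be a metric space with Borel $\sigma$-algebra, $\lambda(n)$ positive numbers with $\lambda(n)\to+\infty$, and $X_n$ (not necessarily measurable) maps from probability spaces $(\Omega_n,\mathcal F_n,P_n)$ to $\mathcal X$. A rate function is a map $I:\mathcal X\to[0,+\infty]$ that is inf-compact, i.e. $\{I\le L\}$ is compact for every $L\in\mathbb R$. $\{X_n\}$ satisfies the LDP with speed $\lambda(n)$ and rate function $I$ if for every open measurable $G$ and every closed measurable $F$, $$\liminf_{n\to\infty}\frac1{\lambda(n)}\log P_{n*}(X_n\in G)\ge-\inf_{x\in G}I(x),\qquad \limsup_{n\to\infty}\frac1{\lambda(n)}\log P_n^*(X_n\in F)\le-\inf_{x\in F}I(x),$$ where $P^*(B)=\inf\{P(A);A\supset B,A\in\mathcal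 F\}$ and $P_*(B)=1-P^*(\Omega\setminus B)$ are outer and inner probability. Conventions: $\inf\emptyset=+\infty$, $\log0=-\infty$. *)

(* Defs.v *)
From HB Require Import structures.
From mathcomp Require Import all_boot all_order all_algebra.
From mathcomp Require Import all_classical all_reals all_analysis.

Set Implicit Arguments.
Unset Strict Implicit.
Unset Printing Implicit Defensive.

Import Order.TTheory GRing.Theory Num.Theory.
Import numFieldNormedType.Exports.

Local Open Scope classical_set_scope.
Local Open Scope ring_scope.

Record compatible_metric (R : realType) (T : topologicalType)
    (d : T -> T -> R) : Prop := CompatibleMetric {
  cmetric_eq0 : forall x y, d x y = 0 <-> x = y ;
  cmetric_ge0 : forall x y, 0 <= d x y ;
  cmetric_sym : forall x y, d x y = d y x ;
  cmetric_triangle : forall x y z, d x z <= d x y + d y z ;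
  cmetric_nbhs : forall x (A : set T),
    nbhs x A <-> exists2 e : R, 0 < e & [set y | d x y < e] `<=` A }.

(* The maps [Phi] and [dPhi] are total functions, but only the values of [Phi]
   on [DPhi] and of [dPhi] on [D0] matter. *)
Definition hadamard_derivative (R : realType) (X Y : topologicalLmodType R)
    (DPhi : set X) (Phi : X -> Y) (theta : X) (D0 : set X) (dPhi : X -> Y)
    : Prop :=
  [/\ DPhi theta,
      {within D0, continuous dPhi} &
      forall (t : nat -> R) (h_ : nat -> X) (h : X),
        (forall n, 0 < t n) -> t n @[n --> \oo] --> (0 : R) ->
        h_ n @[n --> \oo] --> h -> D0 h ->
        (forall n, DPhi (theta + t n *: h_ n)) ->
        (t n)^-1 *: (Phi (theta + t n *: h_ n) - Phi theta) @[n --> \oo]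
          --> dPhi h].

Local Open Scope ereal_scope.

Definition outer_prob (disp : measure_display) (T : measurableType disp)
    (R : realType) (P : probability T R) (B : set T) : \bar R :=
  ereal_inf [set P A | A in [set A | measurable A /\ B `<=` A]].

Definition inner_prob (disp : measure_display) (T : measurableType disp)
    (R : realType) (P : probability T R) (B : set T) : \bar R :=
  1 - outer_prob P (~` B).

Definition rate_function (R : realType) (T : topologicalType)
    (I : T -> \bar R) : Prop :=
  (forall x, 0 <= I x) /\
  (forall L : R, compact [set x | I x <= L%:E]).

(* [<<s open >>] is the Borel sigma-algebra of [T]; the maps [Z n] are not
   assumed to be measurable. *)
Definition LDP (R : realType) (T : topologicalType)
    (disp : nat -> measure_display)
    (Omega : forall n, measurableType (disp n))
    (P : forall n, probability (Omega n) R)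
    (Z : forall n, Omega n -> T) (lambda : nat -> R) (I : T -> \bar R)
    : Prop :=
  [/\ rate_function I,
      forall G : set T, open G -> <<s open >> G ->
        - ereal_inf (I @` G) <=
          limn_einf (fun n =>
            (lambda n)^-1%:E * lne (inner_prob (P n) (Z n @^-1` G))) &
      forall F : set T, closed F -> <<s open >> F ->
        limn_esup (fun n =>
            (lambda n)^-1%:E * lne (outer_prob (P n) (Z n @^-1` F)))
          <= - ereal_inf (I @` F)].

(* Main.v *)
Require Import Defs.
From HB Require Import structures.
From mathcomp Require Import all_boot all_order all_algebra.
From mathcomp Require Import all_classical all_reals all_analysis.

(** The rescaled maps Z_n = r_n (X_n - theta) satisfy an LDP, and
    r_n (Phi (X_n) - Phi theta) = q_n (Z_n) for the difference quotients
    q_n (z) = r_n (Phi (theta + z / r_n) - Phi theta).  Both conclusions are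
    thus instances of a contraction principle in which the map varies with n.

    Hadamard differentiability says that q_{m_k} (z_k) tends to dPhi x whenever
    m_k tends to infinity and z_k tends to x in D0, with q_{m_k} defined at z_k
    ([hadamard_quotient_cvg]).  The step 1 / r_n may run along any reindexing m,
    so a diagonal argument over balls of radius 1 / (k + 1) makes the
    convergence locally uniform: for each open G containing dPhi x there is a
    neighbourhood U of x such that, for all large n, q_n maps the part of U on
    which it is defined into G ([uniform_of_sequential]).

    This is all that a contraction principle needs
    ([LDP_extended_contraction]).  Write W_n = q_n (Z_n).  For the lower bound,
    the event that W_n lies in G contains the event that Z_n lies in U.  For
    the upper bound with a closed F and a level L below the infimum of the image
    rate on F, no point of the compact set {I <= L} is mapped into F; by
    compactness, W_n in F forces, for n large, Z_n to lie in a single closed set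
    C disjoint from {I <= L} ([compact_closed_avoid]), and the upper bound for
    Z_n on C applies.  Events are compared by inclusion only, which outer and
    inner probabilities respect for arbitrary sets.  The image rate has compact
    sublevel sets since {I_f <= L} is the intersection of the compact sets
    f ({I <= L + e}) over e > 0 ([rate_function_image]).

    The first conclusion takes f = dPhi.  The second takes the constant f = 0
    and the quotients q_n - dPhi, which tend to 0 in the same sense; the image
    of I under a constant is the degenerate rate because the infimum of I is 0
    ([LDP_inf_rate]).  The tail estimate is the upper bound on the closed set of
    points at distance at least delta from 0, where that rate is infinite. *)

Set Implicit Arguments.
Unset Strict Implicit.
Unset Printing Implicit Defensive.

Import Order.TTheory GRing.Theory Num.Theory.
Import numFieldNormedType.Exports.

Local Open Scope classical_set_scope.
Local Open Scope ring_scope.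

(** * Monotonicity of logarithmic outer and inner probabilities *)

Section LogProbability.
Local Open Scope ereal_scope.
Context {R : realType}.

Lemma le_lne (x y : \bar R) : x <= y -> lne x <= lne y.
Proof.
have [x0|x0] := leP x 0; first by rewrite (le0_lneNy x0) leNye.
move=> xy; rewrite lee_lne// in_itv/= leey andbT; first exact: ltW.
exact: le_trans (ltW x0) xy.
Qed.

(** Bounds on rates are checked at real levels, since only these have compact
    sublevel sets. *)
Lemma lee_below (x y : \bar R) :
  (forall L : R, L%:E < x -> L%:E <= y) -> x <= y.
Proof.
case: x => [x| |] xy; last exact: leNye.
  by apply/lee_subgt0Pr => e e0; apply: xy; rewrite lte_fin ltrBlDr ltrDl.
by rewrite (eq_infty (fun L => xy L (ltry L))).
Qed.

(** Only ranks from some point on matter: shrink each tail set in the infimum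
    defining the upper limit of [v] to the ranks where [u n <= v n]. *)
Lemma limn_esup_near_le (u v : nat -> \bar R) :
  (\forall n \near \oo, u n <= v n) -> limn_esup u <= limn_esup v.
Proof.
move=> uv; apply: le_ereal_inf_tmp => _ [V V_oo <-].
apply: ge_ereal_inf; exists (ereal_sup (u @` (V `&` [set n | u n <= v n]))).
  by exists (V `&` [set n | u n <= v n]) => //; exact: filterI.
apply: ge_ereal_sup => _ [n [Vn /= le_uv] <-]; apply: le_trans le_uv _.
by apply: ereal_sup_ubound; exists n.
Qed.

Lemma limn_einf_near_le (u v : nat -> \bar R) :
  (\forall n \near \oo, u n <= v n) -> limn_einf u <= limn_einf v.
Proof.
move=> uv; rewrite /limn_einf leeN2; apply: limn_esup_near_le.
by apply: filterS uv => n; rewrite leeN2.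
Qed.

Lemma limn_esup_cst (c : \bar R) : limn_esup (fun _ => c) = c.
Proof.
have c_cvg : (fun=> c) @ \oo --> c by exact: cvg_cst.
by have [_ ->] := cvg_limn_einf_sup c_cvg.
Qed.

Context {disp : measure_display} {T : measurableType disp}.
Variable P : probability T R.

Lemma le_outer_prob (A B : set T) :
  A `<=` B -> outer_prob P A <= outer_prob P B.
Proof.
move=> AB; apply: le_ereal_inf => _ [C [mC BC] <-].
by exists C => //; split=> //; exact: subset_trans BC.
Qed.

Lemma le_inner_prob (A B : set T) :
  A `<=` B -> inner_prob P A <= inner_prob P B.
Proof. by move=> AB; apply: leeB => //; exact/le_outer_prob/subsetC. Qed.

Lemma outer_probT : outer_prob P setT = 1.
Proof.
apply/eqP; rewrite eq_le; apply/andP; split.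
  apply: ge_ereal_inf; exists (P setT); last by rewrite probability_setT.
  by exists setT.
apply: le_ereal_inf_tmp => _ [A [mA TA] <-].
have -> : A = setT by apply/seteqP; split=> // w _; exact: TA.
by rewrite probability_setT.
Qed.

End LogProbability.

(** * Topology: Borel sets, compactness and compatible metrics *)

Section BorelSets.
Context {T : topologicalType}.

Lemma borel_open (A : set T) : open A -> <<s open >> A.
Proof. exact: sub_sigma_algebra. Qed.

Lemma borel_closed (A : set T) : closed A -> <<s open >> A.
Proof.
move=> cA; rewrite -(setCK A) -setTD.
by apply: sigma_algebraCD; apply: borel_open; exact: closed_openC.
Qed.

End BorelSets.

(** Plays the part of a finite subcover.  Let C be a small member of [H]: near
    each point of [K] it lies outside an open U, hence so does its closure, and
    compactness makes one C serve all of [K].  If [H] is improper, the empty set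
    already is such a member. *)
Lemma compact_closed_avoid (T : topologicalType) (H : set_system T)
    (FH : Filter H) (K : set T) :
  compact K -> (forall x, K x -> exists2 U, open_nbhs x U & H (~` U)) ->
  exists C, [/\ closed C, H C & K `<=` ~` C].
Proof.
move=> /compact_near_coveringP K_cover KH.
have [H0|H_proper] := pselect (H set0).
  by exists set0; split=> [|//|x _ []]; exact: closed0.
have PH : ProperFilter H by exact: Build_ProperFilter.
have : \forall C \near powerset_filter_from H, K `<=` ~` closure C.
  apply: K_cover => x /KH[U [oU Ux] HU]; near_simpl.
  exists (U, [set C | C `<=` ~` U]) => /=.
    by split; [exact: open_nbhs_nbhs|exact: small_set_sub].
  move=> [z C] /= [Uz CU] /(closure_subset CU).
  by rewrite -(closure_id _).1; [exact|exact: open_closedC].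
move=> /near_powerset_filter_fromP[A B AB KB x Kx /(closure_subset AB)|C HC KC].
  exact: KB.
exists (closure C); split => //; first exact: closed_closure.
by apply: filterS HC; exact: subset_closure.
Qed.

Section CompatibleMetric.
Context {R : realType}.

(** Balls of half the distance around two points cannot meet. *)
Lemma compatible_metric_hausdorff (T : topologicalType) (d : T -> T -> R) :
  compatible_metric d -> hausdorff_space T.
Proof.
move=> [d0 d_ge0 d_sym d_tri d_nbhs] x y xy.
apply/d0/eqP; rewrite eq_le d_ge0 andbT leNgt; apply/negP => dxy.
have h0 : 0 < d x y / 2 by rewrite divr_gt0.
have B u : nbhs u [set z | d u z < d x y / 2].
  by apply/d_nbhs; exists (d x y / 2).
have [z [/= xz]] := xy _ _ (B x) (B y); rewrite d_sym => zy.
by have := le_lt_trans (d_tri x z y) (ltrD xz zy); rewrite -splitr ltxx.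
Qed.

Lemma closed_far_from (T : topologicalType) (d : T -> T -> R) (x : T) (e : R) :
  compatible_metric d -> closed [set y | e <= d y x].
Proof.
move=> [_ _ d_sym d_tri d_nbhs]; rewrite -openC openE => y /= /negP.
rewrite -ltNge => dyx; apply/d_nbhs; exists (e - d y x).
  by rewrite subr_gt0.
move=> z /=; rewrite ltrBrDr => dyz; apply/negP; rewrite -ltNge.
by apply: le_lt_trans (d_tri z y x) _; rewrite (d_sym z y).
Qed.

(** A diagonal argument: if no ball of radius 1 / (k + 1) around [x] works from
    rank k on, pick for each k a counterexample (m k, z k) with m k >= k.  Then
    m tends to infinity and z tends to [x], yet g (m k) (z k) stays outside
    [G]. *)
Lemma uniform_of_sequential (X Y : topologicalType) (d : X -> X -> R)
    (hd : compatible_metric d) (E : nat -> set X) (g : nat -> X -> Y)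
    (x : X) (y : Y) :
  (forall (m : nat -> nat) (z : nat -> X),
     m k @[k --> \oo] --> \oo -> z k @[k --> \oo] --> x ->
     (forall k, E (m k) (z k)) -> g (m k) (z k) @[k --> \oo] --> y) ->
  forall G, open G -> G y ->
    exists2 U, open_nbhs x U &
      \forall n \near \oo, forall z, U z -> E n z -> G (g n z).
Proof.
move: hd => [_ _ _ _ d_nbhs] seq_cvg G oG Gy; apply: contrapT => noU.
pose B (k : nat) := [set z | d x z < k.+1%:R^-1].
have nbhsB k : nbhs x (B k).
  by apply/d_nbhs; exists k.+1%:R^-1; rewrite ?invr_gt0.
have /choice[mz Hmz] : forall k, exists mz : nat * X,
    [/\ (k <= mz.1)%N, B k mz.2, E mz.1 mz.2 & ~ G (g mz.1 mz.2)].
  move=> k; apply: contrapT => no_mz; apply: noU; exists (interior (B k)).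
    by split; [exact: open_interior|exact: nbhsB].
  exists k => // n /= kn z /interior_subset Bz Ez.
  by apply: contrapT => nGz; apply: no_mz; exists (n, z).
have : g (mz k).1 (mz k).2 @[k --> \oo] --> y.
  apply: (seq_cvg (fun k => (mz k).1) (fun k => (mz k).2)).
  - apply/cvgnyPge => N; exists N => // k /= Nk.
    by have [/(leq_trans Nk)] := Hmz k.
  - move=> A /d_nbhs[e e0 eA].
    apply: filterS (near_infty_natSinv_lt (PosNum e0)) => k /= ke.
    by apply: eA; have [_ Bk _ _] := Hmz k; exact: lt_trans Bk ke.
  - by move=> k; have [] := Hmz k.
move=> /(_ G (open_nbhs_nbhs (conj oG Gy)))[k _ /(_ k (leqnn k)) /= Gk].
by have [_ _ _] := Hmz k; exact.
Qed.

End CompatibleMetric.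

(** * Image rate functions *)

Section InfOverFibre.
Local Open Scope ereal_scope.
Context {R : realType}.

(** The upper bound on the whole space reads 0 <= - inf I, as the event there
    has probability 1. *)
Lemma LDP_inf_rate (T : topologicalType) (disp : nat -> measure_display)
    (Omega : forall n, measurableType (disp n))
    (P : forall n, probability (Omega n) R) (Z : forall n, Omega n -> T)
    (lambda : nat -> R) (I : T -> \bar R) :
  LDP P Z lambda I -> ereal_inf (range I) = 0.
Proof.
move=> [[I_ge0 _] _ upper]; apply/eqP; rewrite eq_le; apply/andP; split.
  have := upper setT closedT (borel_closed closedT).
  rewrite (_ : (fun n => _) = fun=> 0); last first.
    by apply/funext => n; rewrite preimage_setT outer_probT lne1 mule0.
  by rewrite limn_esup_cst leeNr oppe0.
by apply: le_ereal_inf_tmp => _ [x _ <-].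
Qed.

(** The image rate is at most L at y exactly when, for every e > 0, the fibre
    over y meets {I <= L + e}: the margin e absorbs the gap between an infimum
    and the values it bounds.  Sublevel sets of the image rate are thus
    intersections of images of compact sets, which are closed as [Y] is
    Hausdorff. *)
Lemma rate_function_image (X Y : topologicalType) (hY : hausdorff_space Y)
    (I : X -> \bar R) (D0 : set X) (f : X -> Y) :
  rate_function I -> [set x | I x < +oo] `<=` D0 ->
  {within D0, continuous f} ->
  rate_function
    (fun y => ereal_inf [set I x | x in [set x | D0 x /\ f x = y]]).
Proof.
move=> [I_ge0 I_cpt] ID0 cf; split=> [y|L].
  by apply: le_ereal_inf_tmp => _ [x _ <-].
pose K (M : R) := [set x | I x <= M%:E].
have KD0 M : K M `<=` D0.
  by move=> x Kx; apply: ID0; exact: le_lt_trans Kx (ltry _).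
have cpt_fK M : compact (f @` K M).
  apply: continuous_compact; last exact: I_cpt.
  exact: (@continuous_subspaceW X Y _ _ f (KD0 M)) cf.
have -> : [set y | ereal_inf [set I x | x in [set x | D0 x /\ f x = y]] <= L%:E]
    = \bigcap_(e in [set e : R | (0 < e)%R]) (f @` K (L + e)%R).
  apply/seteqP; split=> y /= yL.
    move=> e e0.
    have : ereal_inf [set I x | x in [set x | D0 x /\ f x = y]] < (L + e)%:E.
      by apply: le_lt_trans yL _; rewrite lte_fin ltrDl.
    move=> /ereal_inf_lt[_ [x [D0x <-] <-] Ix].
    by exists x => //; exact: ltW.
  apply/lee_addgt0Pr => e e0; have [x Kx <-] := yL e e0.
  apply: ge_ereal_inf; exists (I x); last by rewrite -EFinD.
  by exists x => //; split=> //; exact: KD0 Kx.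
apply: (subclosed_compact _ (cpt_fK (L + 1)%R)).
  by apply: closed_bigI => e _; exact: compact_closed.
by move=> y; apply; rewrite /= ltr01.
Qed.

(** Over [y0] the fibre is all of [D0], where the infimum of [I] is already
    approached because [I] is infinite elsewhere; all other fibres are empty. *)
Lemma inf_rate_fibre_cst (X : topologicalType) (Y : eqType)
    (disp : nat -> measure_display)
    (Omega : forall n, measurableType (disp n))
    (P : forall n, probability (Omega n) R) (Z : forall n, Omega n -> X)
    (lambda : nat -> R) (I : X -> \bar R) (D0 : set X) (y0 : Y) :
  LDP P Z lambda I -> [set x | I x < +oo] `<=` D0 ->
  (fun y => ereal_inf [set I x | x in [set x | D0 x /\ y0 = y]]) =
  (fun y => if y == y0 then 0 else +oo).
Proof.
move=> ldpI ID0; apply/funext => y; case: eqVneq => [->|y_neq]; last first.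
  rewrite (_ : [set _ | _ in _] = set0) ?ereal_inf0//.
  by rewrite -subset0 => e [x [_ y0y] _]; move: y_neq; rewrite y0y eqxx.
apply/eqP; rewrite eq_le; apply/andP; split.
  apply/lee_addgt0Pr => e e0; rewrite add0e.
  have : ereal_inf (range I) < e%:E by rewrite (LDP_inf_rate ldpI).
  move=> /ereal_inf_lt[_ [x _ <-] Ixe].
  apply: ge_ereal_inf; exists (I x); last exact: ltW.
  by exists x => //; split=> //; apply: ID0; exact: lt_trans Ixe (ltry _).
apply: le_ereal_inf_tmp => _ [x _ <-].
by have [[I_ge0 _] _ _] := ldpI.
Qed.

End InfOverFibre.

(** * The extended contraction principle *)

Section ExtendedContraction.
Local Open Scope ereal_scope.

(** The last hypothesis is the only link between the two families: as long as
    [Z n] is close to a point [x] of [D0], [W n] eventually stays in a given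
    neighbourhood of [f x], from a rank that is the same for all outcomes.  It
    covers [W n = g n (Z n)] for functions [g n] that converge to [f] locally
    uniformly at the points of [D0]. *)
Theorem LDP_extended_contraction (R : realType) (X Y : topologicalType)
    (hY : hausdorff_space Y) (disp : nat -> measure_display)
    (Omega : forall n, measurableType (disp n))
    (P : forall n, probability (Omega n) R)
    (Z : forall n, Omega n -> X) (W : forall n, Omega n -> Y)
    (lambda : nat -> R) (lambda_gt0 : forall n, (0 < lambda n)%R)
    (I : X -> \bar R) (D0 : set X) (f : X -> Y) :
  LDP P Z lambda I -> [set x | I x < +oo] `<=` D0 ->
  {within D0, continuous f} ->
  (forall x G, D0 x -> open G -> G (f x) ->
     exists2 U, open_nbhs x U &
       \forall n \near \oo, forall w, U (Z n w) -> G (W n w)) ->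
  LDP P W lambda
    (fun y => ereal_inf [set I x | x in [set x | D0 x /\ f x = y]]).
Proof.
move=> [rateI lower upper] ID0 cf ZW.
have le_log n (a b : \bar R) : a <= b ->
    (lambda n)^-1%:E * lne a <= (lambda n)^-1%:E * lne b.
  by move=> ab; rewrite lee_pmul2l ?lte_fin ?invr_gt0// le_lne.
split; first exact: rate_function_image.
- move=> G oG _; rewrite leeNl; apply: le_ereal_inf_tmp => _ [y Gy <-].
  apply: le_ereal_inf_tmp => _ [x [D0x fxy] <-]; rewrite leeNl.
  have Gfx : G (f x) by rewrite fxy.
  have [U [oU Ux] UG] := ZW x G D0x oG Gfx.
  apply: (@le_trans _ _ (- ereal_inf (I @` U))).
    by rewrite leeN2; apply: ereal_inf_lbound; exists x.
  apply: le_trans (lower U oU (borel_open oU)) _.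
  apply: limn_einf_near_le; apply: filterS UG => n UG.
  exact/le_log/le_inner_prob.
- move=> F cF _; rewrite leeNr; apply: lee_below => L L_lt; rewrite leeNr.
  (* The sets that eventually contain Z_n on the event that W_n lies in F. *)
  pose H : set_system X :=
    [set A | \forall n \near \oo, forall w, F (W n w) -> A (Z n w)].
  have filterH : Filter H.
    split=> [|A B|A B AB]; rewrite /H /=.
    - exact: nearW.
    - by apply: filterS2 => n HA HB w FW; split; [exact: HA|exact: HB].
    - by apply: filterS => n HA w FW; exact/AB/HA.
  have [|C [cC HC CK]] := compact_closed_avoid filterH (rateI.2 L).
    move=> x IxL.
    have D0x : D0 x by apply: ID0; exact: le_lt_trans IxL (ltry _).
    have nFfx : (~` F) (f x).
      move=> Ffx; move: L_lt; rewrite ltNge => /negP; apply.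
      apply: ge_ereal_inf.
      exists (ereal_inf [set I z | z in [set z | D0 z /\ f z = f x]]).
        by exists (f x).
      by apply: ge_ereal_inf; exists (I x) => //; exists x.
    have [U xU UF] := ZW x _ D0x (closed_openC cF) nFfx; exists U => //.
    by move: UF; rewrite /H /=; apply: filterS => n UF w FW UZ; exact: UF FW.
  apply: (@le_trans _ _ (- ereal_inf (I @` C))).
    apply: le_trans (upper _ cC (borel_closed cC)).
    apply: limn_esup_near_le; move: HC; rewrite /H /=; apply: filterS => n HC.
    exact/le_log/le_outer_prob.
  rewrite leeN2; apply: le_ereal_inf_tmp => _ [x Cx <-].
  by rewrite leNgt; apply/negP => /ltW IxL; exact: CK Cx.
Qed.

End ExtendedContraction.

(** * The delta method *)

Section HadamardQuotient.
Context {R : realType} {X Y : topologicalLmodType R}.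

(** The definition with steps t_k = 1 / r (m k); reindexing by [m] is possible
    because the definition quantifies over all positive null sequences. *)
Lemma hadamard_quotient_cvg (DPhi D0 : set X) (Phi : X -> Y) (theta : X)
    (dPhi : X -> Y) (r : nat -> R) (m : nat -> nat) (z : nat -> X) (x : X) :
  hadamard_derivative DPhi Phi theta D0 dPhi ->
  (forall n, 0 < r n) -> r n @[n --> \oo] --> +oo ->
  m k @[k --> \oo] --> \oo -> z k @[k --> \oo] --> x -> D0 x ->
  (forall k, DPhi (theta + (r (m k))^-1 *: z k)) ->
  r (m k) *: (Phi (theta + (r (m k))^-1 *: z k) - Phi theta) @[k --> \oo]
    --> dPhi x.
Proof.
move=> [_ _ hPhi] r_gt0 r_oo m_oo zx D0x Dz.
have t_gt0 k : 0 < (r (m k))^-1 by rewrite invr_gt0.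
have t_cvg0 : (r (m k))^-1 @[k --> \oo] --> (0 : R).
  apply/gtr0_cvgV0; first by apply: nearW => k.
  exact: cvg_comp m_oo r_oo.
have := hPhi _ z x t_gt0 t_cvg0 zx D0x Dz.
by under eq_fun do rewrite invrK.
Qed.

End HadamardQuotient.

Theorem theorem3p1 (R : realType) (X Y : topologicalLmodType R)
    (d : X -> X -> R) (rho : Y -> Y -> R)
    (hd : compatible_metric d) (hrho : compatible_metric rho)
    (DPhi D0 : set X) (Phi : X -> Y) (theta : X) (dPhi : X -> Y)
    (hPhi : hadamard_derivative DPhi Phi theta D0 dPhi)
    (disp : nat -> measure_display)
    (Omega : forall n, measurableType (disp n))
    (P : forall n, probability (Omega n) R)
    (Xn : forall n, Omega n -> X)
    (hXn : forall n w, DPhi (Xn n w))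
    (r : nat -> R) (hr0 : forall n, 0 < r n) (hr : r n @[n --> \oo] --> +oo)
    (lambda : nat -> R) (hlambda0 : forall n, 0 < lambda n)
    (hlambda : lambda n @[n --> \oo] --> +oo)
    (I : X -> \bar R)
    (hLDP : LDP P (fun n w => r n *: (Xn n w - theta)) lambda I)
    (hI : [set x | (I x < +oo)%E] `<=` D0) :
  LDP P (fun n w => r n *: (Phi (Xn n w) - Phi theta)) lambda
    (fun y => ereal_inf [set I x | x in [set x | D0 x /\ dPhi x = y]]) /\
  (continuous dPhi ->
    LDP P (fun n w => r n *: (Phi (Xn n w) - Phi theta)
                      - dPhi (r n *: (Xn n w - theta))) lambda
      (fun z => if z == 0 then 0%E else +oo%E) /\
    forall delta : R, 0 < delta ->
      limn_esup (fun n =>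
        ((lambda n)^-1%:E *
         lne (outer_prob (P n)
           [set w | (delta <= rho (r n *: (Phi (Xn n w) - Phi theta)
                                 - dPhi (r n *: (Xn n w - theta))) 0)%R]))%E)
      = -oo%E).
Proof.
pose Z n w := r n *: (Xn n w - theta).
pose q n z := r n *: (Phi (theta + (r n)^-1 *: z) - Phi theta).
pose E n := [set z | DPhi (theta + (r n)^-1 *: z)].
have XnE n w : theta + (r n)^-1 *: Z n w = Xn n w.
  by rewrite scalerA mulVf ?gt_eqF// scale1r addrC subrK.
have EZ n w : E n (Z n w) by rewrite /E /= XnE.
have cdPhi : {within D0, continuous dPhi} by have [] := hPhi.
have hY : hausdorff_space Y := compatible_metric_hausdorff hrho.
split.
  apply: (LDP_extended_contraction hY hlambda0 hLDP hI cdPhi) => x G D0x oG Gx.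
  have [|U xU UG] := @uniform_of_sequential _ _ _ d hd E q x (dPhi x) _ G oG Gx.
    move=> m z m_oo zx Ez.
    exact: hadamard_quotient_cvg hPhi hr0 hr m_oo zx D0x Ez.
  exists U => //; apply: filterS UG => n UG w UZ.
  by have := UG _ UZ (EZ n w); rewrite /q XnE.
move=> cdPhiT; set W := fun n w => _.
have W_LDP : LDP P W lambda (fun z => if z == 0 then 0%E else +oo%E).
  rewrite -(inf_rate_fibre_cst 0 hLDP hI).
  apply: (LDP_extended_contraction (f := fun=> 0) hY hlambda0 hLDP hI).
    by move=> x; exact: cvg_cst.
  move=> x G D0x oG G0.
  have [|U xU UG] := @uniform_of_sequential _ _ _ d hd E
      (fun n z => q n z - dPhi z) x 0 _ G oG G0.
    move=> m z m_oo zx Ez; rewrite -(subrr (dPhi x)).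
    apply: (continuous2_cvg _ (h := fun a b : Y => a - b)).
    - exact: (@sub_continuous Y (dPhi x, dPhi x)).
    - exact: hadamard_quotient_cvg hPhi hr0 hr m_oo zx D0x Ez.
    - exact: continuous_cvg (cdPhiT x) zx.
  exists U => //; apply: filterS UG => n UG w UZ.
  by have := UG _ UZ (EZ n w); rewrite /q XnE.
split=> // delta delta_gt0.
have [_ _ upper] := W_LDP.
have cF := @closed_far_from _ _ _ 0 delta hrho.
apply/eqP; rewrite -leeNy_eq; apply: le_trans (upper _ cF (borel_closed cF)) _.
rewrite leeNl /= leye_eq; apply/eqP/ereal_inf_pinfty => _ [z /= z_far <-].
case: eqVneq => // z0; move: z_far.
by rewrite z0 (proj2 (cmetric_eq0 hrho 0 0))// leNgt delta_gt0.
Qed.
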